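(* Let $(P,\omega)$ be a labeled poset. For ideals $I,I'\in\mathcal I(P)$ let $\theta(I,I';t)$ denote the $(I,I')$-th entry of the matrix $\Theta(P,\omega;t)$. Then $$\theta(I,I';t)=\begin{cases}0 & \text{if } I\nsubseteq I',\\ \Omega(I'\setminus I,\omega;t) & \text{if } I\subseteq I'.\end{cases}$$ In particular, $\theta(\emptyset,P;t)=\Omega(P,\omega;t)$.
   Context: All posets are finite and $\mathbb N^+=\{1,2,\dots\}$, $[n]=\{1,\dots,n\}$. An ideal of a poset $P$ is a down-closed subset ($x\in I$, $y\le x$ imply $y\in I$); $\mathcal I(P)$ is the set of all ideals, including $\emptyset$ and $P$. A labeled poset $(P,\omega)$ is a finite poset $P$ with an injective map $\omega:P\to\mathbb N^+$; each subset $S\subseteq P$ carries the induced order and labeling, giving a labeled poset $(S,\omega)$. A subset $S$ is $\omega$-natural if $\omega|_S$ is order-preserving ($\emptyset$ is $\omega$-natural). A map $f:P\to[n]$ is $\omega$-order-preserving if it is order-preserving and $f(x)>f(y)$ whenever $x>y$ in $P$ and $\omega(x)<\omega(y)$. The order polynomial $\Omega(P,\omega;t)$ is the unique polynomial in $t$ whose value at each $n\in\mathbb N^+$ is the number of $\omega$-order-preserving maps $P\to[n]$; $\Omega(\emptyset,\omega;t)=1$. The matrix $A(P,\omega)$ has rows and columns indexed by $\mathcal I(P)$; its $(I,J)$ entry is $1$ if $I\subsetneq J$ and $J\setminus I$ is $\omega$-natural, and $0$ otherwise (it is the adjacency matrix of the so-called $\omega$-graph of $(P,\omega)$; it is nilpotent,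 and strictly upper triangular for a suitable ordering of the ideals). Define $$\Phi(P,\omega)=\ln(1+A(P,\omega))=\sum_{n\ge1}\frac{(-1)^{n-1}}{n}A(P,\omega)^n,\qquad \Theta(P,\omega;t)=e^{t\Phi(P,\omega)}=\sum_{n\ge0}\frac{\Phi(P,\omega)^n}{n!}t^n .$$ *)

(* Defs.v *)
From HB Require Import structures.
From mathcomp Require Import all_boot all_order all_algebra.
From mathcomp Require Import boolp classical_sets fsbigop.
From mathcomp Require Import finset.

Set Implicit Arguments.
Unset Strict Implicit.
Unset Printing Implicit Defensive.

Import Order.TTheory GRing.Theory Num.Theory.
Local Open Scope ring_scope.

(* A labeled poset is a finite poset T with a labeling w : T -> nat. The
   definitions make sense for any w, so positivity and injectivity of w are left
   as hypotheses of the results that use them. *)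

Section SubPoset.
Context {d : Order.disp_t} {T : finPOrderType d}.

Definition sub_poset (S : {set T}) : Type := {x : T | x \in S}.

HB.instance Definition _ (S : {set T}) :=
  SubType.copy (sub_poset S) {x : T | x \in S}.
HB.instance Definition _ (S : {set T}) := [Finite of sub_poset S by <:].
HB.instance Definition _ (S : {set T}) :=
  [SubChoice_isSubPOrder of sub_poset S by <: with d].

Definition sub_label (w : T -> nat) (S : {set T}) : sub_poset S -> nat :=
  fun x => w (val x).

End SubPoset.

Section OrderPolynomial.
Context {d : Order.disp_t} {T : finPOrderType d}.
Implicit Type w : T -> nat.

(* The chain [n] = {1 < ... < n} is represented by 'I_n = {0 < ... < n-1}. *)
Definition order_preserving w n (f : {ffun T -> 'I_n}) : bool :=
  [forall x, forall y, (x <= y)%O ==> (f x <= f y)%N] &&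
  [forall x, forall y, (y < x)%O && (w x < w y)%N ==> (f y < f x)%N].

Definition order_preserving_count w n : nat :=
  #|[set f : {ffun T -> 'I_n} | order_preserving w f]|.

Definition is_order_poly w (p : {poly rat}) : Prop :=
  forall n : nat, (0 < n)%N -> p.[n%:R] = (order_preserving_count w n)%:R.

Definition order_poly w : {poly rat} := xget 0 [set p | is_order_poly w p]%classic.

Lemma is_order_poly_uniq w p q : is_order_poly w p -> is_order_poly w q -> p = q.
Proof.
move=> hp hq; apply/eqP; rewrite -subr_eq0; apply/negPn/negP => nz.
pose rs : seq rat := [seq i.+1%:R | i <- iota 0 (size (p - q))].
have urs : uniq rs.
  rewrite map_inj_uniq ?iota_uniq // => i j /eqP.
  by rewrite eqr_nat eqSS => /eqP.
have ars : all (root (p - q)) rs.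
  by apply/allP => _ /mapP[i _ ->]; rewrite rootE !hornerE hp // hq // subrr.
by have := max_poly_roots nz ars urs; rewrite size_map size_iota ltnn.
Qed.

Let surj_count w k :=
  #|[set f : {ffun T -> 'I_k} | order_preserving w f & f @: setT == setT]|.

Let count_image w n (B : {set 'I_n}) :
  #|[set f : {ffun T -> 'I_n} | order_preserving w f & f @: setT == B]|
  = surj_count w #|B|.
Proof.
pose h (g : {ffun T -> 'I_#|B|}) : {ffun T -> 'I_n} :=
  [ffun x => Order.enum_val (g x)].
have hle (i j : 'I_#|B|) :
    (Order.enum_val i <= Order.enum_val j)%N = (i <= j)%N.
  exact: (Order.EnumVal.le_enum_val (@le_total _ 'I_n) i j).
have hlt (i j : 'I_#|B|) :
    (Order.enum_val i < Order.enum_val j)%N = (i < j)%N.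
  by rewrite !ltnNge hle.
have hop g : order_preserving w (h g) = order_preserving w g.
  congr (_ && _); apply: eq_forallb => x; apply: eq_forallb => y;
  by rewrite !ffunE ?hle ?hlt.
have h_inj : injective h.
  move=> g1 g2 /ffunP e; apply/ffunP => x; move: (e x); rewrite !ffunE.
  exact: Order.EnumVal.enum_val_inj.
rewrite /surj_count -(card_imset _ h_inj); apply: eq_card => f.
rewrite inE; apply/andP/imsetP => [[fop /eqP fB]|[g]].
  have fxB x : f x \in B by rewrite -fB imset_f.
  pose g := [ffun x => Order.enum_rank_in (fxB x) (f x)].
  have fE : f = h g.
    by apply/ffunP => x; rewrite !ffunE Order.EnumVal.enum_rankK_in.
  exists g => //; rewrite inE -hop -fE fop /=.
  apply/eqP/setP => i; rewrite [RHS]inE.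
  have : Order.enum_val i \in f @: setT by rewrite fB Order.EnumVal.enum_valP.
  case/imsetP => x _; rewrite fE ffunE => /Order.EnumVal.enum_val_inj ->.
  by rewrite imset_f.
rewrite inE => /andP[gop /eqP gT] ->; rewrite hop gop; split=> //.
apply/eqP/setP => i; apply/imsetP/idP => [[x _ ->]|iB].
  by rewrite ffunE Order.EnumVal.enum_valP.
have : Order.enum_rank_in iB i \in g @: setT by rewrite gT inE.
case/imsetP => x _ e; exists x; rewrite // ffunE -e.
by rewrite Order.EnumVal.enum_rankK_in.
Qed.

Let count_binomial w n :
  order_preserving_count w n =
  (\sum_(k < #|T|.+1) surj_count w k * 'C(n, k))%N.
Proof.
rewrite /order_preserving_count -sum1_card.
rewrite (partition_big (fun f : {ffun T -> 'I_n} => f @: setT) predT) //=.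
under eq_bigr => B _.
  rewrite (_ : (\sum_(i | _) 1)%N = surj_count w #|B|); last first.
    rewrite -count_image -sum1_card; apply: eq_bigl => f; by rewrite !inE.
  over.
have Ble (B : {set 'I_n}) : (#|T| < #|B|)%N -> surj_count w #|B| = 0%N.
  move=> lt; apply/eqP; rewrite cards_eq0; apply/eqP/setP => f.
  rewrite !inE; apply/negP => /andP[_ /eqP fT].
  have := leq_imset_card f setT.
  by rewrite fT !cardsT card_ord leqNgt lt.
rewrite (bigID (fun B : {set 'I_n} => (#|B| < #|T|.+1)%N)) /=.
rewrite [X in (_ + X)%N]big1 ?addn0; last first.
  by move=> B; rewrite -leqNgt; exact: Ble.
rewrite (partition_big (fun B : {set 'I_n} => inord #|B| : 'I_#|T|.+1) predT) //=.
apply: eq_bigr => k _.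
rewrite (eq_bigr (fun=> surj_count w k)); last first.
  by move=> B /andP[lt /eqP <-]; rewrite inordK.
rewrite sum_nat_const mulnC; congr (_ * _)%N.
rewrite -[in RHS](card_ord n) -card_draws; apply: eq_card => B; rewrite !inE.
rewrite unfold_in; apply/andP/eqP => [[lt /eqP <-]|->]; first by rewrite inordK.
by rewrite ltn_ord; split=> //; apply/eqP/val_inj; rewrite /= inordK.
Qed.

Lemma is_order_poly_ex w : exists p, is_order_poly w p.
Proof.
pose b k : {poly rat} := (k`!%:R)^-1 *: \prod_(i < k) ('X - i%:R%:P).
have bE k n : (b k).[n%:R] = 'C(n, k)%:R.
  rewrite hornerZ horner_prod.
  have -> : \prod_(i < k) ('X - i%:R%:P).[n%:R] = (n ^_ k)%:R :> rat.
    elim: k => [|k IH]; first by rewrite big_ord0.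
    rewrite big_ord_recr /= IH !hornerE ffactnSr natrM.
    have [le|lt] := leqP k n; first by rewrite natrB.
    by rewrite ffact_small // !mul0r.
  by rewrite -bin_ffact natrM mulrC mulfK // pnatr_eq0 -lt0n fact_gt0.
exists (\sum_(k < #|T|.+1) (surj_count w k)%:R *: b k) => n _.
rewrite horner_sum count_binomial natr_sum; apply: eq_bigr => k _.
by rewrite hornerZ bE natrM.
Qed.

Lemma order_polyP w : is_order_poly w (order_poly w).
Proof. exact: (xgetPex 0 (is_order_poly_ex w)). Qed.

End OrderPolynomial.

Section Theta.
Context {d : Order.disp_t} {P : finPOrderType d}.
Implicit Types (w : P -> nat) (S : {set P}).

Definition is_ideal S : bool :=
  [forall x, forall y, (x \in S) && (y <= x)%O ==> (y \in S)].

Definition ideal : Type := {S : {set P} | is_ideal S}.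

HB.instance Definition _ := SubType.copy ideal {S : {set P} | is_ideal S}.
HB.instance Definition _ := [Finite of ideal by <:].

Definition ideal_set (I : ideal) : {set P} := val I.
Coercion ideal_set : ideal >-> set_of.

Lemma is_ideal_set0 : is_ideal set0.
Proof. by apply/'forall_forallP => x y; rewrite !inE. Qed.

Lemma is_ideal_setT : is_ideal [set: P].
Proof. by apply/'forall_forallP => x y; rewrite !inE implybT. Qed.

Definition ideal0 : ideal := Sub set0 is_ideal_set0.
Definition idealT : ideal := Sub [set: P] is_ideal_setT.

Definition natural w S : bool :=
  [forall x in S, forall y in S, (x <= y)%O ==> (w x <= w y)%N].

(* Matrix indices 'I_#|ideal| stand for ideals through enum_val/enum_rank. *)
Definition mxA w : 'M[rat]_#|{: ideal}| :=
  \matrix_(i, j) let I : ideal := enum_val i in let J : ideal := enum_val j in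
    ((I \proper J) && natural w (J :\: I))%:R.

(* The sums over \in below are finitely supported sums (fsbigop), hence the
   actual values of the infinite series, since mxA and mxPhi are nilpotent
   (mxA_nilp and mxPhi_nilp). *)
Definition mxPhi w : 'M[rat]_#|{: ideal}| :=
  \sum_(n \in [set n | (1 <= n)%N]%classic) ((-1) ^+ n.-1 / n%:R) *: mxA w ^+ n.

Definition mxTheta w : 'M[{poly rat}]_#|{: ideal}| :=
  \sum_(n \in [set: nat]%classic)
    'X^n *: map_mx polyC ((n`!%:R)^-1 *: mxPhi w ^+ n).

Definition theta w (I J : ideal) : {poly rat} :=
  mxTheta w (enum_rank I) (enum_rank J).

Let graded (M : 'M[rat]_#|{: ideal}|) := forall i j, M i j != 0 ->
  (#|(enum_val i : ideal)| < #|(enum_val j : ideal)|)%N.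

Let graded_exp M n i j : graded M -> (M ^+ n) i j != 0 ->
  (#|(enum_val i : ideal)| + n <= #|(enum_val j : ideal)|)%N.
Proof.
move=> gM; elim: n j => [|n IH] j.
  by rewrite expr0 mxE addn0; case: (i =P j) => [->|_]; rewrite ?eqxx.
rewrite exprSr mxE => nz.
have [k] : exists k, (M ^+ n) i k * M k j != 0.
  apply/existsP; apply: contraNT nz; rewrite negb_exists => /forallP h.
  by apply/eqP/big1 => k _; apply/eqP; rewrite -[_ == _]negbK.
rewrite mulf_eq0 negb_or addnS => /andP[/IH le /gM]; exact: leq_ltn_trans.
Qed.

Let graded_nilp M n : graded M -> (#|P| < n)%N -> M ^+ n = 0.
Proof.
move=> gM lt; apply/matrixP => i j; rewrite mxE; apply/eqP/negPn/negP.
move/(graded_exp gM)/(leq_trans (leq_addl _ _)).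
by rewrite leqNgt (leq_ltn_trans (max_card _) lt).
Qed.

Let graded_mxA w : graded (mxA w).
Proof.
move=> i j; rewrite mxE pnatr_eq0 eqb0 negbK => /andP[/proper_card + _].
by [].
Qed.

Lemma mxA_nilp w n : (#|P| < n)%N -> mxA w ^+ n = 0.
Proof. exact/graded_nilp/graded_mxA. Qed.

Lemma mxPhi_nilp w n : (#|P| < n)%N -> mxPhi w ^+ n = 0.
Proof.
apply: graded_nilp => i j; apply: contraR; rewrite -leqNgt => le.
rewrite /mxPhi summxE big1_seq // => k /=.
case: finite_supportP => // X XP _ _ kX.
have k_gt0 : (0 < k)%N := XP _ kX.
rewrite mxE; apply/eqP; rewrite mulf_eq0; apply/orP; right.
apply/negPn/negP => /(graded_exp (@graded_mxA w)) h.
by have := leq_trans h le; rewrite -[leqRHS]addn0 leq_add2l leqNgt k_gt0.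
Qed.

End Theta.

Arguments ideal {d} P.

(* Main.v *)
(** Evaluating [theta] at a positive integer n turns exp (n log (1 + A)) into
    (1 + A)^n: with F the truncation of exp (n log (1 + X)) at order N, both F
    and (1 + X)^n solve (1 + X) Y' = n Y modulo X^N with Y(0) = 1, so they agree
    modulo X^(N+1), which suffices as A is nilpotent. The (I, I') entry of
    (1 + A)^n counts the chains of ideals I = I_0 <= ... <= I_n = I' with natural
    differences, that is, the order-preserving maps f on I' \ I, through
    I_k = I U {f <= k}. *)
Require Import Defs.
From mathcomp Require Import all_boot all_order all_algebra.
From mathcomp Require Import boolp classical_sets fsbigop finset ring.

Set Implicit Arguments.
Unset Strict Implicit.
Unset Printing Implicit Defensive.
Import Order.TTheory GRing.Theory Num.Theory.
Local Open Scope ring_scope.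

(** * Truncated logarithm and exponential series *)

Definition log_poly N : {poly rat} :=
  \sum_(1 <= k < N.+1) ((-1) ^+ k.-1 / k%:R) *: 'X^k.

Definition exp_log_poly N n : {poly rat} :=
  \sum_(k < N.+1) (n%:R ^+ k / k`!%:R) *: log_poly N ^+ k.

(** The derivative is the geometric sum of the powers of [- 'X] below [N], which the factor [1 + 'X]
    telescopes. *)
Lemma deriv_log_poly N : (1 + 'X) * (log_poly N)^`() = 1 - (- 'X) ^+ N.
Proof.
have -> : (log_poly N)^`() = \sum_(i < N) (- 'X) ^+ i.
  rewrite /log_poly big_add1 big_mkord raddf_sum; apply: eq_bigr => i _ /=.
  rewrite derivZ derivXn /= -scaler_nat scalerA divfK ?pnatr_eq0 // [RHS]exprNn.
  by rewrite -[in LHS]signr_odd -[in RHS]signr_odd scaler_sign mulr_sign.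
by rewrite -[RHS]opprB subrX1; ring.
Qed.

(** Used to see that [log_poly N ^+ N] is divisible by ['X^N] and that the series has constant term
    0. *)
Lemma log_poly_factor N : exists M, log_poly N = M * 'X.
Proof.
exists (\sum_(0 <= k < N) ((-1) ^+ k / k.+1%:R) *: 'X^k).
rewrite /log_poly big_add1 mulr_suml; apply: eq_bigr => k _.
by rewrite exprSr scalerAl.
Qed.

Lemma deriv_exp_log_poly N n :
  exists q, (1 + 'X) * (exp_log_poly N n)^`() =
            n%:R * exp_log_poly N n + 'X^N * q.
Proof.
pose L := log_poly N; have [M LM] := log_poly_factor N.
pose c : rat := n%:R ^+ N / N`!%:R.
(* Differentiating the truncated exponential loses its top term, so [E] takes its place on the right
   of [dE]. *)
pose E := \sum_(k < N) (n%:R ^+ k / k`!%:R) *: L ^+ k.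
have F_E : exp_log_poly N n = E + c *: L ^+ N by rewrite /exp_log_poly big_ord_recr.
have dE : (exp_log_poly N n)^`() = n%:R * (L^`() * E).
  rewrite /exp_log_poly big_ord_recl /= expr0 linearD /= derivZ derivC scaler0.
  rewrite add0r raddf_sum !mulr_sumr; apply: eq_bigr => k _.
  rewrite /= /bump leq0n add1n derivZ deriv_exp /= -[_ *+ k.+1]scaler_nat.
  rewrite scalerA -scalerAr.
  rewrite [RHS]mulr_natl -[RHS]scaler_nat scalerA; congr (_ *: _).
  rewrite factS natrM exprS; field; rewrite pnatr_eq0 -lt0n fact_gt0.
  by rewrite nat1r pnatr_eq0.
(* The first summand is the error of the truncated logarithm, the second is the top term missing
   from [E]; both carry a factor ['X^N]. *)
exists (- n%:R * ((-1) ^+ N * E + c *: M ^+ N)).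
rewrite dE F_E.
have -> : (1 + 'X) * (n%:R * (L^`() * E)) = n%:R * (1 - (- 'X) ^+ N) * E.
  by rewrite -deriv_log_poly /L; ring.
rewrite [(- 'X) ^+ N]exprNn.
rewrite /L LM exprMn -!mul_polyC; ring.
Qed.

Lemma coef_eq0_of_deriv N n (D q : {poly rat}) : D`_0 = 0 ->
  (1 + 'X) * D^`() = n%:R * D + 'X^N * q -> forall i, (i <= N)%N -> D`_i = 0.
Proof.
move=> D0 dD; elim=> [//|i IH] lt.
have := congr1 (fun p : {poly rat} => p`_i) dD.
rewrite mulrDl mul1r !coefD coefXM coefXnM lt addr0 -polyC_natr coefCM.
rewrite (IH (ltnW lt)) mulr0 !coef_deriv.
have -> : (if i == 0 then 0 else D`_i.-1.+1 *+ i.-1.+1) = 0.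
  case: eqP => // /eqP; rewrite -lt0n => /prednK ->.
  by rewrite (IH (ltnW lt)) mul0rn.
by rewrite addr0 => /eqP; rewrite mulrn_eq0 /= => /eqP.
Qed.

Lemma take_exp_log_poly N n :
  take_poly N.+1 (exp_log_poly N n) = take_poly N.+1 ((1 + 'X) ^+ n).
Proof.
have [q dF] := deriv_exp_log_poly N n.
set F := exp_log_poly N n in dF *; set G := (1 + 'X) ^+ n.
suff FG i : (i <= N)%N -> (F - G)`_i = 0.
  apply/polyP => i; rewrite !coef_take_poly ltnS; case: leqP => // /FG.
  by rewrite coefB => /eqP; rewrite subr_eq0 => /eqP.
(* The equation is linear and [G] solves it exactly, so [F - G] inherits the error term [q] of
   [F]. *)
move: i; apply: (@coef_eq0_of_deriv N n _ q).
  rewrite -horner_coef0 /F /G /exp_log_poly hornerD hornerN horner_exp.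
  rewrite hornerD hornerX.
  rewrite hornerC addr0 expr1n horner_sum big_ord_recl big1 => [|k _].
    by rewrite !expr0 fact0 divr1 scale1r hornerC addr0 subrr.
  have [M ->] := log_poly_factor N.
  by rewrite hornerZ horner_exp hornerMX mulr0 expr0n mulr0.
rewrite derivB mulrBr dF mulrBr [RHS]addrAC; congr (_ - _).
rewrite /G deriv_exp linearD /= derivC derivX add0r mul1r mulrnAr.
case: n {F G dF} => [|m]; first by rewrite mulr0n mul0r.
by rewrite -exprS mulr_natl.
Qed.

(** * Evaluation at nilpotent matrices *)

Lemma horner_mx_take m N (A : 'M[rat]_m.+1) p :
  A ^+ N = 0 -> horner_mx A (take_poly N p) = horner_mx A p.
Proof.
move=> AN; rewrite -[in RHS](poly_take_drop N p) rmorphD rmorphM rmorphXn /=.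
by rewrite horner_mx_X AN mulr0 addr0.
Qed.

Lemma exp_log_mx m N n (A : 'M[rat]_m) : A ^+ N.+1 = 0 ->
  \sum_(k < N.+1) (n%:R ^+ k / k`!%:R) *:
    (\sum_(1 <= l < N.+1) ((-1) ^+ l.-1 / l%:R) *: A ^+ l) ^+ k = (1 + A) ^+ n.
Proof.
(* All matrices of size 0 are equal; in positive size [horner_mx] transports the polynomial
   identity. *)
case: m A => [|m] A AN; first by rewrite [LHS]flatmx0 [RHS]flatmx0.
have <- : horner_mx A (exp_log_poly N n) = (1 + A) ^+ n.
  rewrite -(horner_mx_take _ AN) take_exp_log_poly (horner_mx_take _ AN).
  by rewrite rmorphXn rmorphD rmorph1 /= horner_mx_X.
rewrite rmorph_sum; apply: eq_bigr => k _; rewrite /= horner_mxZ rmorphXn /=.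
rewrite rmorph_sum; congr (_ *: _ ^+ _); apply: eq_bigr => l _.
by rewrite /= horner_mxZ rmorphXn /= horner_mx_X.
Qed.

(** * Entries of the powers of 1 + A as numbers of layered maps *)

Section Layered.
Context {d : Order.disp_t} {P : finPOrderType d}.
Implicit Types (w : P -> nat) (S : {set P}) (I J K : ideal P).

Lemma mem_ideal_le I x y : x \in (I : {set P}) -> (y <= x)%O -> y \in (I : {set P}).
Proof. by move=> xI yx; have /'forall_forallP/(_ x y) := valP I; rewrite xI yx. Qed.

Lemma mxPhiE w : mxPhi w =
  \sum_(1 <= l < #|P|.+1) ((-1) ^+ l.-1 / l%:R) *: mxA w ^+ l.
Proof.
rewrite /mxPhi (fsbigE (index_iota 1 #|P|.+1)) ?iota_uniq //; last first.
- move=> i /= i1; rewrite mem_index_iota i1 /= ltnS -ltnNge => lt.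
  by rewrite mxA_nilp ?scaler0.
- by move=> i /=; rewrite mem_index_iota => /andP[].
rewrite [LHS]big_seq_cond [RHS]big_seq; apply: eq_bigl => i.
by rewrite mem_index_iota;
  case: (1 <= i)%N / idP => i1; rewrite ?andbF // andbC mem_set.
Qed.

Lemma horner_theta w I J n :
  (theta w I J).[n%:R] = ((1 + mxA w) ^+ n) (enum_rank I) (enum_rank J).
Proof.
rewrite -(@exp_log_mx _ #|P|) ?mxA_nilp // -mxPhiE /theta /mxTheta.
rewrite (fsbigE (iota 0 #|P|.+1)) ?iota_uniq //; last first.
- move=> i _; rewrite mem_iota add0n /= -leqNgt => lt.
  by rewrite mxPhi_nilp // scaler0 map_mx0 scaler0.
rewrite !summxE horner_sum -[iota _ _]/(index_iota 0 #|P|.+1) big_mkord.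
apply: eq_big => [i|i _]; first by rewrite classical_sets.in_setT.
by rewrite !mxE hornerM hornerXn hornerC mulrA.
Qed.

(* A map [f : S -> [n]] is extended by 0 outside S; the codomain 'I_N.+1 does
   not depend on n, so that maps with different n can be compared. *)
Definition layered w N n S (f : {ffun P -> 'I_N.+1}) : bool :=
  [forall x, if x \in S then (0 < f x <= n)%N else f x == 0 :> nat] &&
  [forall x in S, forall y in S, ((x <= y)%O ==> (f x <= f y)%N) &&
     ((y < x)%O && (w x < w y)%N ==> (f y < f x)%N)].

Lemma layeredP w N n S (f : {ffun P -> 'I_N.+1}) : reflect
  [/\ forall x, x \notin S -> f x = 0 :> nat,
      forall x, x \in S -> (0 < f x <= n)%N,
      forall x y, x \in S -> y \in S -> (x <= y)%O -> (f x <= f y)%N &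
      forall x y, x \in S -> y \in S -> (y < x)%O -> (w x < w y)%N ->
        (f y < f x)%N]
  (layered w n S f).
Proof.
apply: (iffP andP) => [[/forallP h0 /forall_inP h]|[h0 h1 h2 h3]].
  split=> [x xS|x xS|x y xS yS xy|x y xS yS yx wxy].
  - by have := h0 x; rewrite (negbTE xS) => /eqP.
  - by have := h0 x; rewrite xS.
  - by have /forall_inP/(_ y yS)/andP[+ _] := h x xS; rewrite xy.
  - by have /forall_inP/(_ y yS)/andP[_ +] := h x xS; rewrite yx wxy.
split.
  by apply/forallP => x; case: ifPn => [/h1|/h0 ->].
apply/forall_inP => x xS; apply/forall_inP => y yS; apply/andP; split.
  by apply/implyP; exact: h2.
by apply/implyP => /andP[]; exact: h3.
Qed.

Definition layered_maps w N n S := [set f : {ffun P -> 'I_N.+1} | layered w n S f].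

Lemma card_layered_maps w N n S : (n <= N)%N ->
  #|layered_maps w N n S| = order_preserving_count (sub_label w (S := S)) n.
Proof.
move=> nN.
(* Values move up by one, since 0 marks the points outside [S]. *)
pose h (g : {ffun sub_poset S -> 'I_n}) : {ffun P -> 'I_N.+1} :=
  [ffun x => oapp (fun u => inord (g u).+1) ord0 (insub x)].
have hv g u : h g (val u) = (g u).+1 :> nat.
  by rewrite ffunE valK /= inordK // ltnS (leq_trans (ltn_ord _) nN).
have h_inj : injective h.
  move=> g1 g2 e; apply/ffunP => u; apply/val_inj/succn_inj.
  by rewrite -!hv e.
rewrite /order_preserving_count -(card_imset _ h_inj); apply: eq_card => f.
rewrite inE; apply/layeredP/imsetP => [[h0 h1 h2 h3]|[g]].
  have fn (u : sub_poset S) : ((f (val u)).-1 < n)%N.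
    by have /andP[f0 fn] := h1 _ (valP u); rewrite prednK.
  have fp (u : sub_poset S) : ((f (val u)).-1.+1 = f (val u))%N.
    by have /andP[f0 _] := h1 _ (valP u); rewrite prednK.
  pose g : {ffun sub_poset S -> 'I_n} := [ffun u => Ordinal (fn u)].
  exists g.
    rewrite inE; apply/andP; split; apply/'forall_forallP => x y;
      apply/implyP; rewrite !ffunE /=.
      by move=> xy; rewrite -ltnS !fp h2 ?(valP x) ?(valP y).
    by move=> /andP[yx wxy]; rewrite -ltnS !fp h3 ?(valP x) ?(valP y).
  apply/ffunP => x; apply/val_inj => /=.
  have [xS|xS] := boolP (x \in S).
    by rewrite -[x]/(val (Sub x xS : sub_poset S)) hv ffunE; apply/esym/(fp (Sub x xS)).
  by rewrite ffunE insubN // h0.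
rewrite inE => /andP[/'forall_forallP g1 /'forall_forallP g2] ->.
have Sx x (xS : x \in S) : x = val (Sub x xS : sub_poset S) by [].
split=> [x xS|x xS|x y xS yS|x y xS yS].
- by rewrite ffunE insubN.
- by rewrite (Sx x xS) hv /= ltn_ord.
- rewrite (Sx x xS) (Sx y yS) !hv ltnS => xy.
  by have /implyP := g1 (Sub x xS) (Sub y yS); apply.
- rewrite (Sx x xS) (Sx y yS) !hv ltnS => yx wxy.
  by have /implyP := g2 (Sub x xS) (Sub y yS); apply; apply/andP.
Qed.

Lemma card_layered_maps0 w N S : #|layered_maps w N 0 S| = (S == set0).
Proof.
have [->|/set0Pn[x xS]] := eqVneq S set0.
  apply: (@eq_card1 _ [ffun=> ord0]) => f; rewrite !inE.
  apply/layeredP/eqP => [[h0 _ _ _]|->].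
    by apply/ffunP => x; apply/val_inj; rewrite ffunE /= h0 // inE.
  by split=> [x _|x|x y|x y]; rewrite ?inE // ffunE.
apply: eq_card0 => f; rewrite inE; apply/negP => /layeredP[_ /(_ x xS) + _ _].
by rewrite leqn0 andbC; case: eqP => // ->.
Qed.

(** For [f] layered on J \ I with top level n + 1, this is the last ideal before [J] in the chain of
    [f]; it contains [I] because [f] is 0 there. *)
Definition lower N n J (f : {ffun P -> 'I_N.+1}) := [set x in J | (f x <= n)%N].

Section Step.
Variables (w : P -> nat) (N n : nat) (I J : ideal P).
Hypotheses (nN : (n < N)%N) (IJ : I \subset J).

Lemma lower_ideal (f : {ffun P -> 'I_N.+1}) : layered w n.+1 (J :\: I) f ->
  [/\ is_ideal (lower n J f), I \subset lower n J f & natural w (J :\: lower n J f)].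
Proof.
case/layeredP => h0 h1 h2 h3; split.
- apply/'forall_forallP => x y; apply/implyP; rewrite !inE => /andP[/andP[xJ fx] yx].
  rewrite (mem_ideal_le xJ yx) /=; have [yI|yI] := boolP (y \in (I : {set P})).
    by rewrite h0 // inE yI.
  apply: leq_trans fx; apply: h2 (yx); rewrite in_setD ?yI ?(mem_ideal_le xJ yx) //.
  rewrite xJ andbT; by apply: contra yI => /mem_ideal_le; apply.
- apply/fintype.subsetP => x xI; rewrite inE (fintype.subsetP IJ) // h0 //.
  by rewrite inE xI.
- apply/forall_inP => x xK; apply/forall_inP => y yK; apply/implyP => xy.
  (* All points removed from [J] share the value n + 1, so the strictness condition rules out a
     label inversion among them. *)
  have JK z : z \in J :\: lower n J f -> z \in J :\: I /\ f z = n.+1 :> nat.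
    move=> zJK; have [zJ lt] : z \in J /\ (n < f z)%N.
      by move: zJK; rewrite !inE => /andP[+ zJ]; rewrite zJ /= -ltnNge.
    have zI : z \in J :\: I by apply: contraTT lt => /h0 ->.
    by have /andP[_ le] := h1 z zI; split=> //; apply/eqP; rewrite eqn_leq le.
  have [[xJ fx] [yJ fy]] := (JK _ xK, JK _ yK).
  rewrite leqNgt; apply/negP => wyx.
  have ltxy : (x < y)%O.
    by rewrite lt_neqAle xy andbT; apply: contraTneq wyx => ->; rewrite ltnn.
  by have := h3 y x yJ xJ ltxy wyx; rewrite fx fy ltnn.
Qed.

(** A map in the fiber is determined by its restriction to K \ I, and any layered map there extends
    by the constant n + 1 on J \ K: this level lies above all others, and naturality makes a
    constant value admissible. *)
Lemma card_layered_fiber K : I \subset K -> K \subset J -> natural w (J :\: K) ->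
  #|[set f in layered_maps w N n.+1 (J :\: I) | lower n J f == K]| =
  #|layered_maps w N n (K :\: I)|.
Proof.
move=> IK KJ /forall_inP natK.
have natJK x y : x \in J :\: K -> y \in J :\: K -> (x <= y)%O -> (w x <= w y)%N.
  by move=> xK yK xy; have /forall_inP/(_ y yK) := natK x xK; rewrite xy.
pose e (g : {ffun P -> 'I_N.+1}) : {ffun P -> 'I_N.+1} :=
  [ffun x => if x \in J :\: K then inord n.+1 else g x].
have eJK g x : x \in J :\: K -> e g x = n.+1 :> nat.
  by move=> xJK; rewrite ffunE xJK inordK.
have eN g x : x \notin J :\: K -> e g x = g x.
  by move=> xJK; rewrite ffunE (negbTE xJK).
have eK g x : x \in (K : {set P}) -> e g x = g x by move=> xK; rewrite eN // inE xK.
have JI x : x \in J :\: I -> (x \in J :\: K) || (x \in K :\: I).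
  by rewrite !inE => /andP[-> ->]; rewrite andbT /= orNb.
have down x y : x \in K :\: I -> y \in J :\: I -> (y <= x)%O -> y \in K :\: I.
  by rewrite !inE => /andP[_ xK] /andP[-> _] /(mem_ideal_le xK).
(* Overwriting loses nothing: maps layered on K \ I are already 0 on J \ K. *)
rewrite -[RHS](@card_in_imset _ _ e) => [|g1 g2]; last first.
  rewrite !inE => /layeredP[g10 _ _ _] /layeredP[g20 _ _ _] /ffunP eg.
  apply/ffunP => x; have [xJK|xJK] := boolP (x \in J :\: K).
    have xKI : x \notin K :\: I.
      by move: xJK; rewrite !inE => /andP[/negbTE->]; rewrite andbF.
    by apply: val_inj; rewrite /= g10 ?g20.
  by have := eg x; rewrite !eN.
apply: eq_card => f; rewrite inE [f \in layered_maps _ _ _ _]inE.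
apply/andP/imsetP => [[/layeredP[h0 h1 h2 h3] /eqP fK]|[g]].
  have fle x : x \in (K : {set P}) -> (f x <= n)%N by rewrite -fK inE => /andP[].
  have KIJI x : x \in K :\: I -> x \in J :\: I.
    by rewrite !inE => /andP[-> /(fintype.subsetP KJ)].
  pose g : {ffun P -> 'I_N.+1} := [ffun x => if x \in K :\: I then f x else ord0].
  have gK x : x \in K :\: I -> g x = f x by move=> xK; rewrite ffunE xK.
  exists g.
    rewrite inE; apply/layeredP; split=> [x xK|x xK|x y xK yK|x y xK yK].
    - by rewrite ffunE (negbTE xK).
    - rewrite gK // fle; last by move: xK; rewrite inE => /andP[].
      by rewrite andbT; case/andP: (h1 x (KIJI _ xK)).
    - by rewrite !gK //; apply: h2; exact: KIJI.
    - by rewrite !gK //; apply: h3; exact: KIJI.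
  apply/ffunP => x; apply: val_inj => /=.
  have [xJK|xJK] := boolP (x \in J :\: K).
    rewrite eJK //; have xJI : x \in J :\: I.
      move: xJK; rewrite !inE => /andP[+ ->].
      by rewrite andbT; apply/contra/(fintype.subsetP IK).
    have /andP[_ le] := h1 x xJI; apply/eqP; rewrite eqn_leq le ltnNge.
    by move: xJK; rewrite inE -fK inE negb_and => /andP[+ xJ]; rewrite xJ.
  rewrite eN // ffunE; case: ifPn => // xKI; rewrite h0 //.
  by apply: contra xKI => /JI; rewrite (negbTE xJK).
rewrite inE => /layeredP[h0 h1 h2 h3] ->; split; last first.
  apply/eqP/setP => x; rewrite inE; have [xJ|xJ] := boolP (x \in (J : {set P}));
    last first.
    by apply/esym; apply: contraNF xJ; exact: (fintype.subsetP KJ).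
  have [xK|xK] := boolP (x \in (K : {set P})); last by rewrite eJK ?ltnn // inE xK.
  rewrite eK //; have [xKI|xKI] := boolP (x \in K :\: I); last by rewrite h0.
  by case/andP: (h1 x xKI).
have eKI x : x \in K :\: I -> e g x = g x by rewrite inE => /andP[_ /eK].
apply/layeredP; split=>
  [x xJI|x /JI /orP[xJK|xKI]|x y xJI yJI xy|x y xJI yJI yx wxy].
- rewrite eN; last first.
    apply: contra xJI; rewrite !inE => /andP[+ ->].
    by rewrite andbT; apply/contra/(fintype.subsetP IK).
  rewrite h0 //; apply: contra xJI; rewrite !inE => /andP[->].
  exact: (fintype.subsetP KJ).
- by rewrite eJK //=.
- by rewrite eKI //; have /andP[-> /leqW] := h1 x xKI.
- case/orP: (JI y yJI) => [yJK|yKI].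
    rewrite (eJK _ y) //; case/orP: (JI x xJI) => [/eJK->//|xKI].
    by rewrite eKI //; have /andP[_ /leqW] := h1 x xKI.
  (* As [K] is an ideal, a point of level n + 1 never lies below one of K \ I. *)
  have xKI := down _ _ yKI xJI xy; rewrite !eKI //; exact: h2.
- case/orP: (JI x xJI) => [xJK|xKI].
    rewrite (eJK _ x) //; case/orP: (JI y yJI) => [yJK|yKI].
      by have := natJK y x yJK xJK (ltW yx); rewrite leqNgt wxy.
    by rewrite eKI // ltnS; case/andP: (h1 y yKI).
  have yKI := down _ _ xKI yJI (ltW yx); rewrite !eKI //; exact: h3.
Qed.

Lemma card_layered_step : #|layered_maps w N n.+1 (J :\: I)| =
  (\sum_(K : ideal P | (I \subset K) && ((K \subset J) && natural w (J :\: K)))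
     #|layered_maps w N n (K :\: I)|)%N.
Proof.
rewrite -sum1_card.
(* The default [I] of [insubd] is never reached, since [lower n J f] is an ideal for every layered
   [f]. *)
rewrite (partition_big (fun f => insubd I (lower n J f))
  (fun K : ideal P => (I \subset K) && ((K \subset J) && natural w (J :\: K)))) /=.
  apply: eq_bigr => K /andP[IK /andP[KJ natK]].
  rewrite -(card_layered_fiber IK KJ natK) -sum1_card; apply: eq_bigl => f.
  rewrite [in RHS]inE; apply: andb_id2l; rewrite inE => /lower_ideal[idf _ _].
  by rewrite -(inj_eq val_inj (insubd _ _)) val_insubd idf.
move=> f; rewrite inE => /lower_ideal[idf If natf].
have -> : ideal_set (insubd I (lower n J f)) = lower n J f.
  by rewrite /ideal_set val_insubd idf.
rewrite If natf andbT /=; apply/fintype.subsetP => x; rewrite inE; by case/andP.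
Qed.

End Step.

(** The identity matrix supplies the case [I = J], whose difference is empty and hence natural, so
    strict inclusion becomes inclusion. *)
Lemma mxA1E w I J :
  (1 + mxA w) (enum_rank I) (enum_rank J) =
  ((I \subset J) && natural w (J :\: I))%:R.
Proof.
rewrite !mxE !enum_rankK (inj_eq enum_rank_inj).
rewrite /= finset.properEneq; have [<-|neq] := eqVneq I J.
  have -> : natural w (I :\: I) by apply/forall_inP => x; rewrite setDv inE.
  by rewrite eqxx subxx addr0.
by rewrite -(inj_eq val_inj) in neq; rewrite neq add0r.
Qed.

(** Splitting off the last factor gives a sum over the ideal [K] preceding [J], which is the
    recursion of [card_layered_step]; without [I \subset J] no such [K] exists. *)
Lemma mxA1_exp w N n I J : (n <= N)%N ->
  ((1 + mxA w) ^+ n) (enum_rank I) (enum_rank J) =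
  if I \subset J then #|layered_maps w N n (J :\: I)|%:R else 0.
Proof.
elim: n J => [|n IH] J nN.
  rewrite expr0 mxE (inj_eq enum_rank_inj) card_layered_maps0 setD_eq0.
  by rewrite -(inj_eq val_inj) eqEsubset; case: (I \subset J).
rewrite exprSr mxE (reindex enum_rank) /=; last exact/onW_bij/enum_rank_bij.
under eq_bigr => K _ do rewrite mxA1E IH ?(ltnW nN) //.
have [IJ|IJ] := boolP (I \subset J).
  rewrite card_layered_step // natr_sum [RHS]big_mkcond /=; apply: eq_bigr => K _.
  case: (I \subset K); last by rewrite mul0r.
  by case: (_ && _); rewrite ?mulr1 ?mulr0.
apply: big1 => K _; case: ifP => IK; last by rewrite mul0r.
have [KJ|] := boolP (K \subset J); last by rewrite mulr0.
by rewrite (fintype.subset_trans IK KJ) in IJ.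
Qed.

End Layered.

(** * From values at positive integers to polynomials *)

Lemma order_preserving_count_iso d1 d2 (T1 : finPOrderType d1)
    (T2 : finPOrderType d2) (w1 : T1 -> nat) (w2 : T2 -> nat) (h : T1 -> T2) n :
  bijective h -> {mono h : x y / (x <= y)%O} -> (forall x, w2 (h x) = w1 x) ->
  order_preserving_count w1 n = order_preserving_count w2 n.
Proof.
case=> k hK kH hle hw.
pose r (f : {ffun T2 -> 'I_n}) : {ffun T1 -> 'I_n} := [ffun x => f (h x)].
pose r' (f : {ffun T1 -> 'I_n}) : {ffun T2 -> 'I_n} := [ffun x => f (k x)].
have rK : cancel r r' by move=> f; apply/ffunP => x; rewrite !ffunE kH.
have r'K : cancel r' r by move=> f; apply/ffunP => x; rewrite !ffunE hK.
have hlt x y : (h x < h y)%O = (x < y)%O by rewrite !lt_leAnge !hle.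
rewrite /order_preserving_count -(card_imset _ (can_inj rK)); apply: eq_card => f.
rewrite -[f]r'K (mem_imset _ _ (can_inj rK)) !inE; set g := r' f.
apply/andP/andP => -[/'forall_forallP h1 /'forall_forallP h2];
  split; apply/'forall_forallP => x y.
- by have := h1 (k x) (k y); rewrite !ffunE !kH -hle !kH.
- by have := h2 (k x) (k y); rewrite !ffunE !kH -hlt -!hw !kH.
- by have := h1 (h x) (h y); rewrite !ffunE hle.
- by have := h2 (h x) (h y); rewrite !ffunE hlt !hw.
Qed.

Theorem lemma2p5 (d : Order.disp_t) (P : finPOrderType d) (omega : P -> nat)
    (omega_gt0 : forall x : P, (0 < omega x)%N)
    (omega_inj : injective omega) :
  (forall I I' : ideal P,
     theta omega I I' =
       if I \subset I' then order_poly (sub_label omega (S := I' :\: I)) else 0)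
  /\ theta omega ideal0 idealT = order_poly omega.
Proof.
have main I I' : theta omega I I' =
    if I \subset I' then order_poly (sub_label omega (S := I' :\: I)) else 0.
  have E n : (theta omega I I').[n%:R] = if I \subset I' then
      (order_preserving_count (sub_label omega (S := I' :\: I)) n)%:R else 0.
    by rewrite horner_theta (mxA1_exp _ _ _ (leqnn n)) card_layered_maps.
  case: ifP E => _ E; first by apply: is_order_poly_uniq (order_polyP _) => n _.
  (* Adding an order polynomial to both sides reduces the vanishing of [theta] to the uniqueness of
     order polynomials. *)
  apply: (addrI (order_poly omega)); rewrite addr0.
  apply: is_order_poly_uniq (order_polyP _) => n n0.
  by rewrite hornerD E addr0 order_polyP.
split=> //; rewrite main sub0set.
apply: is_order_poly_uniq (order_polyP omega) => n n0.
rewrite order_polyP //; congr _%:R.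
(* [P] and its subposet on the complement of the empty ideal are different types, identified through
   [val]. *)
apply: (order_preserving_count_iso n
  (h := fun u : sub_poset (idealT :\: ideal0) => val u)) => //.
have xT (x : P) : x \in idealT :\: ideal0 by rewrite !inE.
exists (fun x => Sub x (xT x) : sub_poset (idealT :\: ideal0)) => x;
  first exact: val_inj.
by [].
Qed.
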